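(* Consider a finite irreducible Markov renewal process with state space $S=\{1,\dots,m\}$, embedded (jump) chain transition matrix $P$ with stationary probability vector $\pi$, mean sojourn time vector $\mu$, $\lambda=\pi^T\mu>0$, and mean first passage times $m_{ij}$. Let $k^{\circ(1)}=(k^{\circ(1)}_1,\dots,k^{\circ(1)}_m)^T$ with $k_i^{\circ(1)}=\sum_{j=1,\,j\ne i}^m \pi_j m_{ij}$. Then: (a) If $G$ is any g-inverse of $I-P$, then $$k^{\circ(1)}=G\mu-\mathrm{tr}(G\mu\pi^T)e-\lambda Ge+\lambda\,\mathrm{tr}(G)e.$$ (b) If $Z=[I-P+\Pi]^{-1}$, then $$k^{\circ(1)}=Z\mu-\mathrm{tr}(Z\mu\pi^T)e+\lambda(\mathrm{tr}(Z)-1)e.$$ (c) If $A^{\#}$ is the group inverse of $I-P$, then $$k^{\circ(1)}=A^{\#}\mu-\mathrm{tr}(A^{\#}\mu\pi^T)e+\lambda\,\mathrm{tr}(A^{\#})e.$$ (d) If $\widetilde G=[I-P+\mu u^T]^{-1}$, where $u\in\mathbb{R}^m$ satisfies $u^Te\neq0$, then $$k^{\circ(1)}=\lambda\left[\mathrm{tr}(\widetilde G)I-\widetilde G\right]e.$$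
   Context: A Markov renewal process (MRP) $\{(X_n,T_n),n\ge 0\}$ on $S=\{1,\dots,m\}$ has $T_0=0\le T_1\le T_2\le\cdots$ and semi-Markov kernel $Q_{ij}(t)=P\{X_{n+1}=j,\ T_{n+1}-T_n\le t\mid X_n=i\}$ (Markov property: conditionally on the past up to step $n$, the law of $(X_{n+1},T_{n+1}-T_n)$ depends only on $X_n$, through this kernel). The embedded Markov chain $\{X_n\}$ has transition matrix $P=[p_{ij}]$, $p_{ij}=Q_{ij}(+\infty)$; the MRP is called irreducible when $P$ is irreducible. Put $\mu_{ij}=\int_0^\infty t\,dQ_{ij}(t)$, assumed finite, and $\mu_i=\sum_k\mu_{ik}$, the mean sojourn time on a visit to state $i$; $\mu=(\mu_1,\dots,\mu_m)^T$. $\pi=(\pi_1,\dots,\pi_m)^T$ is the unique vector with $\pi^TP=\pi^T$, $\pi^Te=1$, where $e=(1,\dots,1)^T$; $\Pi=e\pi^T$. $\lambda=\pi^T\mu$, assumed positive. The mean first passage time is $m_{ij}=E[T_{ij}\mid X_0=i]$, where $T_{ij}=T_n$ with $n=\min\{r\ge1: X_r=j\}$ given $X_0=i$ (the return time if $i=j$); these are all finite. A g-inverse (one-condition generalized inverse) of $I-P$ is any matrix $G$ with $(I-P)G(I-P)=I-P$. The group inverse $A^{\#}$ of $A=I-P$ is the unique matrix with $AA^{\#}A=A$, $A^{\#}AA^{\#}=A^{\#}$, $AA^{\#}=A^{\#}A$; it equals $Z-\Pi$. *)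

(* Defs.v *)
From HB Require Import structures.
From mathcomp Require Export all_boot all_order all_algebra.
From mathcomp Require Export all_classical all_reals all_analysis.
Export Order.TTheory GRing.Theory Num.Theory numFieldNormedType.Exports.

Set Implicit Arguments.
Unset Strict Implicit.
Unset Printing Implicit Defensive.

Global Open Scope classical_set_scope.
Global Open Scope ring_scope.

Section semi_markov_kernel.
Context (R : realType) (m : nat).

(* [Q i j t] is Q_{ij}(t); being a family of conditional probabilities, it is
   nondecreasing and right-continuous in [t], which [cumulative] records.  The
   other properties (Q_{ij}(t) = 0 for t < 0, \sum_j Q_{ij}(+oo) = 1) follow
   from [is_MRP] below. *)
Implicit Type Q : 'I_m -> 'I_m -> cumulative R R.

Definition transition_matrix Q : 'M[R]_m :=
  \matrix_(i, j) lim (Q i j t @[t --> +oo]).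

Definition mean_sojourn_part Q (i j : 'I_m) : \bar R :=
  (\int[lebesgue_stieltjes_measure (Q i j)]_(t in `[0%R, +oo[) t%:E)%E.

Definition mean_sojourn Q : 'cV[R]_m :=
  \col_i \sum_j fine (mean_sojourn_part Q i j).

Definition irreducible_mx (P : 'M[R]_m) : Prop :=
  forall i j, exists n : nat, 0 < (P ^+ n) i j.

End semi_markov_kernel.

Section markov_renewal_process.
Context (d : measure_display) (Omega : measurableType d) (R : realType).
Context (m : nat).
Variables (X : nat -> Omega -> 'I_m) (T : nat -> Omega -> R).

(* The sigma-algebra generated by X_0, ..., X_n, T_0, ..., T_n. *)
Definition past (n : nat) : set_system Omega :=
  <<s [set H | exists2 k, (k <= n)%N &
         (exists A : set 'I_m, H = X k @^-1` A) \/
         (exists2 B : set R, measurable B & H = T k @^-1` B)] >>.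

(* In [MRP_markov], multiplying by the probability of the conditioning event
   expresses P(X_{n+1} = j, T_{n+1} - T_n <= t | past up to n) = Q_{X_n j}(t)
   without dividing by a probability that may vanish. *)
Record is_MRP (Pr : probability Omega R) (Q : 'I_m -> 'I_m -> cumulative R R)
    : Prop := {
  MRP_measurable_state : forall n i, measurable (X n @^-1` [set i]);
  MRP_measurable_time : forall n, measurable_fun setT (T n);
  MRP_time0 : forall w, T 0%N w = 0;
  MRP_time_nondecreasing : forall n w, T n w <= T n.+1 w;
  MRP_markov : forall n i j t H, past n H ->
    Pr (H `&` [set w | X n w = i]
          `&` [set w | X n.+1 w = j /\ T n.+1 w - T n w <= t]) =
    (Pr (H `&` [set w | X n w = i]) * (Q i j t)%:E)%E
}.

(* T_n for the least n >= 1 with X_n = j, and +oo when there is no such n. *)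
Definition first_passage_time (j : 'I_m) (w : Omega) : \bar R :=
  if pselect (exists n, (0 < n)%N && (X n w == j)) is left ex
  then (T (ex_minn ex) w)%:E else +oo%E.

(* [Pr i] plays the role of the conditional law given X_0 = i.  A separate law
   for each initial state makes every m_{ij} meaningful even where a single
   initial distribution would give some states no mass. *)
Variable Pr : 'I_m -> probability Omega R.

Definition mean_first_passage (i j : 'I_m) : \bar R :=
  (\int[Pr i]_w first_passage_time j w)%E.

Definition weighted_mean_passage (pi : 'cV[R]_m) : 'cV[\bar R]_m :=
  \col_i (\sum_(j < m | j != i) (pi j 0)%:E * mean_first_passage i j)%E.

End markov_renewal_process.

Section generalized_inverses.
Context (R : realType) (m : nat).
Implicit Types A G : 'M[R]_m.

Definition is_g_inverse A G : Prop := A *m G *m A = A.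

Definition is_group_inverse A G : Prop :=
  [/\ A *m G *m A = A, G *m A *m G = G & A *m G = G *m A].

End generalized_inverses.

(* Main.v *)
(* Let B_j be the jump matrix P with its column j replaced by zero.  The first
   passage time to j is the sum over n of the increments T_(n+1) - T_n on the
   event that j is avoided at steps 1, ..., n; by the Markov property the
   n-th expectation, started from i, is (B_j^n mu)_i.  Irreducibility makes
   1 - B_j invertible and B_j^n e tend to 0, so that the vector m_j of mean
   passage times to j is (1 - B_j)^-1 mu, i.e. m_j = mu + B_j m_j.
   Multiplying by pi^T gives pi_j m_jj = lambda; hence the matrix K with zero
   diagonal and off-diagonal entries pi_j m_ij, whose row sums are the entries
   of k, solves (1 - P) K = mu pi^T - lambda 1.  The kernel of 1 - P is spanned
   by e, so K = G (mu pi^T - lambda 1) + e c^T for any g-inverse G, and the zero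
   diagonal determines c.  The three other inverses are special g-inverses. *)
Require Import Defs.
From mathcomp Require Import measurable_realfun.

Set Implicit Arguments.
Unset Strict Implicit.
Unset Printing Implicit Defensive.

(** * Powers of square matrices and a kernel criterion for invertibility *)

Section square_matrices.
Context (m : nat).

Lemma exprS_mx (R : pzRingType) (A : 'M[R]_m) n : A ^+ n.+1 = A *m A ^+ n.
Proof. by rewrite exprS. Qed.

Lemma exprSr_mx (R : pzRingType) (A : 'M[R]_m) n : A ^+ n.+1 = A ^+ n *m A.
Proof. by rewrite exprSr. Qed.

Lemma mx_expr_fix (R : pzRingType) (A : 'M[R]_m) (x : 'cV[R]_m) n :
  A *m x = x -> A ^+ n *m x = x.
Proof.
move=> Ax; elim: n => [|n IH]; first by rewrite expr0 mul1mx.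
by rewrite exprSr_mx -mulmxA Ax.
Qed.

Lemma mx_expr_fixl (R : pzRingType) (A : 'M[R]_m) (x : 'rV[R]_m) n :
  x *m A = x -> x *m A ^+ n = x.
Proof.
move=> Ax; elim: n => [|n IH]; first by rewrite expr0 mulmx1.
by rewrite exprS_mx mulmxA Ax.
Qed.

Lemma mx_expr_ge0 (R : numDomainType) (A : 'M[R]_m) :
  (forall i j, 0 <= A i j) -> forall n i j, 0 <= (A ^+ n) i j.
Proof.
move=> A0; elim=> [|n IH] i j; first by rewrite expr0 !mxE ler0n.
by rewrite exprS_mx mxE; apply: sumr_ge0 => l _; rewrite mulr_ge0.
Qed.

Lemma unitmx_ker0 (F : fieldType) (A : 'M[F]_m) :
  (forall x : 'cV_m, A *m x = 0 -> x = 0) -> A \in unitmx.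
Proof.
move=> A0; rewrite -unitmx_tr -row_free_unit -kermx_eq0; apply/rowV0P => v.
move=> /sub_kermxP vA; apply/trmx_inj; rewrite trmx0; apply: A0.
by apply/trmx_inj; rewrite trmx_mul trmxK vA trmx0.
Qed.

End square_matrices.

(** * Irreducible stochastic matrices and their taboo matrices *)

Section irreducible_stochastic_matrix.
Context (R : realType) (m : nat).
Variable P : 'M[R]_m.
Local Notation e := (const_mx 1 : 'cV[R]_m).
Hypothesis P_ge0 : forall i j, 0 <= P i j.
Hypothesis P_row : P *m e = e.
Hypothesis P_irr : irreducible_mx P.

(* Minimum principle: subtracting the least entry leaves a nonnegative fixed
   vector that vanishes somewhere, hence everywhere. *)
Lemma fixed_const (x : 'cV[R]_m) : P *m x = x -> exists c, x = c *: e.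
Proof.
move=> Px; have [i0 _|noI] := pickP 'I_m; last first.
  by exists 0; apply/matrixP => i; have := noI i.
have [i _ imin] := @arg_minP _ _ _ i0 xpredT (fun i => x i 0) isT.
exists (x i 0); apply/matrixP => l a; rewrite !ord1 !mxE mulr1.
pose y := x - x i 0 *: e.
have y_ge0 k : 0 <= y k 0 by rewrite !mxE mulr1 subr_ge0 imin.
have Py : P *m y = y by rewrite mulmxBr Px -scalemxAr P_row.
have [n Pn] := P_irr i l.
have /matrixP/(_ i 0) := mx_expr_fix n Py.
have Pn0 := mx_expr_ge0 P_ge0 n.
rewrite [X in _ = X]mxE !mxE mulr1 subrr => /eqP.
rewrite psumr_eq0; last by move=> k _; rewrite mulr_ge0.
move=> /allP/(_ l); rewrite mem_index_enum => /(_ isT).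
by rewrite mulf_eq0 gt_eqF//= !mxE mulr1 subr_eq0 => /eqP.
Qed.

Variable pi : 'cV[R]_m.
Hypothesis pi_stat : pi^T *m P = pi^T.
Hypothesis pi_sum : pi^T *m e = 1%:M.

(* The vector of absolute values is again stationary: it is dominated by its
   image under P, and both have the same sum. *)
Lemma stationary_neq0 j : pi j 0 != 0.
Proof.
pose a := map_mx (@Num.norm _ R) pi^T.
have a_le l : a 0 l <= (a *m P) 0 l.
  have piE : pi l 0 = \sum_k pi k 0 * P k l.
    have /matrixP/(_ 0 l) := pi_stat; rewrite !mxE => <-.
    by apply: eq_bigr => k _; rewrite mxE.
  rewrite !mxE piE (le_trans (ler_norm_sum _ _ _))//.
  by apply: ler_sum => k _; rewrite normrM !mxE (ger0_norm (P_ge0 k l)).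
have aP : a *m P = a.
  have /matrixP/(_ 0 0)/eqP : (a *m P - a) *m e = 0.
    by rewrite mulmxBl -mulmxA P_row subrr.
  rewrite mxE (mxE _ _ 0 0) psumr_eq0; last first.
    by move=> k _; rewrite !mxE mulr1 subr_ge0; have := a_le k; rewrite !mxE.
  move=> /allP H; apply/matrixP => i l; rewrite ord1.
  have := H l; rewrite mem_index_enum => /(_ isT).
  by rewrite [X in _ * X]mxE mulr1 !mxE subr_eq0 => /eqP.
have [i pii] : exists i, pi i 0 != 0.
  apply: contrapT => /forallNP pi0; have /matrixP/(_ 0 0)/eqP := pi_sum.
  rewrite !mxE big1 ?mulr1n; first by rewrite eq_sym oner_eq0.
  by move=> k _; rewrite !mxE mulr1; apply/eqP/negPn/negP; exact: pi0.
have [n Pn] := P_irr i j.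
have /matrixP/(_ 0 j) := mx_expr_fixl n aP.
rewrite -normr_gt0 !mxE => <-.
rewrite (bigD1 i)//= ltr_pwDl//.
  by rewrite !mxE mulr_gt0// normr_gt0.
by apply: sumr_ge0 => k _; rewrite !mxE mulr_ge0// mx_expr_ge0.
Qed.

(** The matrix B_j: the chain killed on entering j. Row j is kept, so a start in j is allowed and
    return times are covered too. *)
Definition taboo (j : 'I_m) : 'M[R]_m :=
  \matrix_(k, l) (if l == j then 0 else P k l).

Lemma taboo_mul j (x : 'cV[R]_m) :
  taboo j *m x = P *m x - x j 0 *: col j P.
Proof.
apply/matrixP => i a; rewrite ord1 !mxE (bigD1 j)//= [in RHS](bigD1 j)//=.
rewrite mxE eqxx mul0r add0r addrAC (mulrC (x j 0)) subrr add0r.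
by apply: eq_bigr => k /negbTE kj; rewrite mxE kj.
Qed.

Lemma stationary_taboo j (x : 'cV[R]_m) :
  pi^T *m (taboo j *m x) = pi^T *m x - (pi j 0 * x j 0)%:M.
Proof.
rewrite taboo_mul mulmxBr mulmxA pi_stat -scalemxAr colE [X in _ *: X]mulmxA
  pi_stat -colE.
congr (_ - _); apply/matrixP => a b; rewrite !ord1 !mxE eqxx mulr1n.
by rewrite mulrC.
Qed.

(** Pairing with pi gives pi_j x_j = 0, so x_j = 0 because pi_j is nonzero. Then x is fixed by P
    itself, hence constant, and its entry j is 0. *)
Lemma taboo_fixed j (x : 'cV[R]_m) : taboo j *m x = x -> x = 0.
Proof.
move=> Bx; have xj : x j 0 = 0.
  have := stationary_taboo j x.
  rewrite Bx -{1}[pi^T *m x]subr0 => /addrI/oppr_inj/matrixP/(_ 0 0)/esym/eqP.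
  by rewrite !mxE eqxx mulr1n mulf_eq0 (negbTE (stationary_neq0 j)) => /eqP.
have [c xc] : exists c, x = c *: e.
  by apply: fixed_const; rewrite -{2}Bx taboo_mul xj scale0r subr0.
by move: xj; rewrite xc !mxE mulr1 => ->; rewrite scale0r.
Qed.

Lemma unitmx_taboo j : 1%:M - taboo j \in unitmx.
Proof.
apply: unitmx_ker0 => x; rewrite mulmxBl mul1mx => /eqP.
by rewrite subr_eq0 => /eqP/esym/taboo_fixed.
Qed.

Lemma taboo_ge0 j k l : 0 <= taboo j k l.
Proof. by rewrite mxE; case: ifP. Qed.

(** Since B_j e <= e, the nonnegative vectors B_j^n e decrease and converge. Their limit is fixed by
    B_j, hence zero by [taboo_fixed]. *)
Lemma taboo_expr_cvg0 j i : (taboo j ^+ n *m e) i 0 @[n --> \oo] --> 0.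
Proof.
pose v n := taboo j ^+ n *m e.
have v_ge0 n k : 0 <= v n k 0.
  rewrite mxE; apply: sumr_ge0 => l _.
  by rewrite mulr_ge0 ?mxE// mx_expr_ge0//; exact: taboo_ge0.
have vS n : v n.+1 = taboo j *m v n by rewrite /v exprS_mx mulmxA.
have v_le n k : v n.+1 k 0 <= v n k 0.
  elim: n k => [|n IH] k.
    rewrite vS /v expr0 mul1mx taboo_mul P_row !mxE mul1r lerBlDr lerDl.
    exact: P_ge0.
  rewrite (vS n) (vS n.+1) mxE [leRHS]mxE.
  by apply: ler_sum => l _; apply: ler_wpM2l; [exact: taboo_ge0|exact: IH].
have v_cvg k : cvgn (fun n => v n k 0).
  apply: nonincreasing_is_cvgn.
    by apply/nonincreasing_seqP => n; exact: v_le.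
  by exists 0 => _ [n _ <-].
pose w : 'cV[R]_m := \col_k limn (fun n => v n k 0).
have w0 : w = 0.
  apply: (@taboo_fixed j); apply/matrixP => k a; rewrite ord1.
  have c1 : v n.+1 k 0 @[n --> \oo] --> w k 0.
    by rewrite mxE (cvg_shiftS (fun n => v n k 0)); exact: v_cvg.
  have c2 : v n.+1 k 0 @[n --> \oo] --> (taboo j *m w) k 0.
    under eq_fun do rewrite vS mxE.
    rewrite mxE; apply: cvg_big => [|l _]; first exact: add_continuous.
     apply: cvgMl_tmp.
    by rewrite [X in _ --> X]mxE; exact: v_cvg.
  exact: (cvg_unique _ c2 c1).
have := v_cvg i; suff -> : 0 = limn (fun n => v n i 0) by [].
by have /matrixP/(_ i 0) := w0; rewrite !mxE.
Qed.

(** Neumann series: with b = y - B_j y the partial sums telescope to y - B_j^n y. *)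
Lemma taboo_series_cvg j (b : 'cV[R]_m) i :
  (\sum_(0 <= k < n) (taboo j ^+ k *m b) i 0) @[n --> \oo] -->
    (invmx (1%:M - taboo j) *m b) i 0.
Proof.
set y := invmx _ *m b.
have y_eq : b = y - taboo j *m y.
  by rewrite -{1}[y]mul1mx -mulmxBl mulKVmx// unitmx_taboo.
clearbody y.
have sumE n : \sum_(0 <= k < n) (taboo j ^+ k *m b) i 0 =
    y i 0 - (taboo j ^+ n *m y) i 0.
  elim: n => [|n IH]; first by rewrite big_geq// expr0 mul1mx subrr.
  rewrite big_nat_recr//= IH y_eq mulmxBr mulmxA -exprSr_mx.
  rewrite [in X in _ + X]mxE addrA subrK.
  by congr (_ + _); rewrite mxE.
under eq_fun do rewrite sumE.
suff By0 : (taboo j ^+ n *m y) i 0 @[n --> \oo] --> 0.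
  by have := cvgB (cvg_cst (y i 0)) By0; rewrite subr0; exact.
(* C bounds every |y_k|, so |B_j^n y| <= C B_j^n e entrywise, which tends to 0. *)
pose C := \sum_k `|y k 0|.
have yC k : `|y k 0| <= C.
  by rewrite /C (bigD1 k)//= lerDl; apply: sumr_ge0.
apply: norm_cvg0.
apply: (@squeeze_cvgr _ _ _ _ (cst 0) (fun n => (taboo j ^+ n *m e) i 0 * C)).
- near=> n; rewrite normr_ge0/= mxE (le_trans (ler_norm_sum _ _ _))//.
  rewrite mxE mulr_suml; apply: ler_sum => k _.
  rewrite normrM ger0_norm ?mx_expr_ge0//; last exact: taboo_ge0.
  by rewrite -mulrA ler_wpM2l ?mx_expr_ge0 ?mxE ?mul1r//; exact: taboo_ge0.
- exact: cvg_cst.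
- have := cvgMr_tmp (b := C) (@taboo_expr_cvg0 j i).
  by rewrite mul0r; exact.
Unshelve. all: by end_near. Qed.

End irreducible_stochastic_matrix.

(** * Solving (1 - P) K = mu pi^T - lambda 1 with generalized inverses *)

Section passage_equation.
Context (R : realType) (m : nat).
Variables (P K : 'M[R]_m) (pi mu : 'cV[R]_m) (lambda : R).
Local Notation e := (const_mx 1 : 'cV[R]_m).
Hypothesis fixP : forall x : 'cV_m, P *m x = x -> exists c, x = c *: e.
Hypothesis P_row : P *m e = e.
Hypothesis pi_stat : pi^T *m P = pi^T.
Hypothesis pi_sum : pi^T *m e = 1%:M.
Hypothesis lambda_def : pi^T *m mu = lambda%:M.
Hypothesis lambda_neq0 : lambda != 0.
Hypothesis K_eq : (1%:M - P) *m K = mu *m pi^T - lambda%:M.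
Hypothesis K_diag : forall i, K i i = 0.

Let ker1P (x : 'cV_m) : (1%:M - P) *m x = 0 -> exists c, x = c *: e.
Proof.
by rewrite mulmxBl mul1mx => /eqP; rewrite subr_eq0 => /eqP/esym/fixP.
Qed.

Let Pe0 : (1%:M - P) *m e = 0.
Proof. by rewrite mulmxBl mul1mx P_row subrr. Qed.

Let piP0 : pi^T *m (1%:M - P) = 0.
Proof. by rewrite mulmxBr mulmx1 pi_stat subrr. Qed.

Lemma g_inverse_passage G : is_g_inverse (1%:M - P) G ->
  K *m e = G *m mu - \tr (G *m mu *m pi^T) *: e
           - lambda *: (G *m e) + (lambda * \tr G) *: e.
Proof.
move=> GA; pose D := G *m (mu *m pi^T - lambda%:M).
have [c cE] : exists c : 'I_m -> R, forall j, col j K = col j D + c j *: e.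
  (* (1 - P) D = (1 - P) G (1 - P) K = (1 - P) K, so the columns of K - D lie in the kernel of 1 -
     P. *)
  have Hc j : exists c, col j (K - D) = c *: e.
    apply: ker1P; rewrite colE mulmxA mulmxBr /D -K_eq !mulmxA GA subrr.
    by rewrite mul0mx.
  exists (fun j => sval (cid (Hc j))) => j; case: cid => c /= <-.
  by rewrite linearB/= addrC subrK.
have cD j : c j = - D j j.
  have /matrixP/(_ j 0) := cE j; rewrite !mxE K_diag mulr1 => /esym/eqP.
  by rewrite addrC addr_eq0 => /eqP.
(* The constants add up to -tr D, which is the source of both trace terms. *)
have sumc : \sum_j c j = lambda * \tr G - \tr (G *m mu *m pi^T).
  under eq_bigr do rewrite cD.
  rewrite sumrN -/(\tr D) /D mulmxBr mul_mx_scalar linearB/= linearZ/=.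
  by rewrite opprB mulmxA.
have -> : K *m e = D *m e + (\sum_j c j) *: e.
  apply/matrixP => i a; rewrite ord1 !mxE mulr1 -big_split/=.
  apply: eq_bigr => j _; have /matrixP/(_ i 0) := cE j.
  by rewrite [e j 0]mxE !mulr1 !mxE mulr1.
rewrite sumc /D mulmxBr mulmxBl mul_mx_scalar -scalemxAl -!mulmxA pi_sum mulmx1.
by rewrite scalerBl addrA addrAC; congr (_ + _); rewrite addrAC.
Qed.

(** As pi^T annihilates 1 - P, a kernel vector x has pi^T x = 0. It is then a multiple of e, and
    pi^T e = 1 makes it zero. *)
Lemma fundamental_unitmx : 1%:M - P + e *m pi^T \in unitmx.
Proof.
apply: unitmx_ker0 => x Ax0.
have pix : pi^T *m x = 0.
  have := congr1 (mulmx pi^T) Ax0.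
  by rewrite mulmx0 mulmxA mulmxDr piP0 add0r mulmxA pi_sum mul1mx.
move: Ax0; rewrite mulmxDl -mulmxA pix mulmx0 addr0 => /ker1P[c xc].
move: pix; rewrite xc -scalemxAr pi_sum => /matrixP/(_ 0 0).
by rewrite !mxE mulr1 => ->; rewrite scale0r.
Qed.

(** From Z e = e follows (1 - P) Z e pi^T = 0, so Z is a g-inverse; the term lambda Z e = lambda e
    accounts for the -1 beside the trace. *)
Lemma fundamental_passage : let Z := invmx (1%:M - P + e *m pi^T) in
  K *m e = Z *m mu - \tr (Z *m mu *m pi^T) *: e + (lambda * (\tr Z - 1)) *: e.
Proof.
move=> Z; have uW := fundamental_unitmx.
have Ze : Z *m e = e.
  rewrite -[in RHS](mulKmx uW e); congr (_ *m _).
  by rewrite mulmxDl Pe0 add0r -mulmxA pi_sum mulmx1.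
have gZ : is_g_inverse (1%:M - P) Z.
  rewrite /is_g_inverse -[1%:M - P in X in _ *m X](addrK (e *m pi^T)).
  rewrite -mulmxA [Z *m _]mulmxBr mulVmx// mulmxBr mulmx1.
  by rewrite !mulmxA -[_ *m Z *m e]mulmxA Ze Pe0 mul0mx subr0.
rewrite (g_inverse_passage gZ) Ze -!addrA; congr (_ + (_ + _)).
by rewrite mulrBr mulr1 scalerBl addrC.
Qed.

(** Commutation yields Ag e = Ag Ag (1 - P) e = 0, which removes one term of the g-inverse
    formula. *)
Lemma group_inverse_passage Ag : is_group_inverse (1%:M - P) Ag ->
  K *m e = Ag *m mu - \tr (Ag *m mu *m pi^T) *: e + (lambda * \tr Ag) *: e.
Proof.
case=> AGA GAG AG; rewrite (g_inverse_passage AGA).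
suff -> : Ag *m e = 0 by rewrite scaler0 subr0.
by rewrite -GAG -[Ag *m _ *m Ag]mulmxA AG -!mulmxA Pe0 !mulmx0.
Qed.

Section rank_one_update.
Variable u : 'cV[R]_m.
Hypothesis ue_neq0 : (u^T *m e) 0 0 != 0.

(** Applying pi^T to the kernel equation leaves lambda u^T x = 0. As lambda is nonzero, x lies in
    the kernel of 1 - P and is a multiple of e, which u^T e != 0 forces to be zero. *)
Lemma rank_one_unitmx : 1%:M - P + mu *m u^T \in unitmx.
Proof.
apply: unitmx_ker0 => x Ax0.
have ux : u^T *m x = 0.
  have := congr1 (mulmx pi^T) Ax0.
  rewrite mulmx0 mulmxA mulmxDr piP0 add0r mulmxA lambda_def mul_scalar_mx.
  by rewrite -scalemxAl => /eqP;
    rewrite scaler_eq0 (negbTE lambda_neq0) => /eqP.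
move: Ax0; rewrite mulmxDl -mulmxA ux mulmx0 addr0 => /ker1P[c xc].
move: ux; rewrite xc -scalemxAr => /matrixP/(_ 0 0)/eqP.
by rewrite [_ 0 0]mxE [X in _ == X]mxE mulf_eq0 (negbTE ue_neq0) orbF =>
  /eqP->; rewrite scale0r.
Qed.

(** Since (1 - P + mu u^T) e = (u^T e) mu, the vector Gt mu is a multiple of e. This makes Gt a
    g-inverse and cancels the two terms in mu, because pi^T e = 1. *)
Lemma rank_one_passage : let Gt := invmx (1%:M - P + mu *m u^T) in
  K *m e = lambda *: (((\tr Gt) *: 1%:M - Gt) *m e).
Proof.
move=> Gt; have uW := rank_one_unitmx.
pose c := (u^T *m e) 0 0.
have Gmu : Gt *m mu = c^-1 *: e.
  apply: (canRL (scalerK ue_neq0)).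
  rewrite -[in RHS](mulKmx uW e) scalemxAr; congr (_ *m _).
  rewrite mulmxDl Pe0 add0r -mulmxA [u^T *m e]mx11_scalar mul_mx_scalar.
  by rewrite [_%:M 0 0]mxE mulr1n.
have gG : is_g_inverse (1%:M - P) Gt.
  rewrite /is_g_inverse -[1%:M - P in X in _ *m X](addrK (mu *m u^T)).
  rewrite -mulmxA [Gt *m _]mulmxBr mulVmx// mulmxBr mulmx1.
  by rewrite [Gt *m _]mulmxA Gmu -scalemxAl -scalemxAr mulmxA Pe0 mul0mx
    scaler0 subr0.
rewrite (g_inverse_passage gG) Gmu -scalemxAl mxtraceZ mxtrace_mulC pi_sum.
rewrite mxtrace1 mulr1 subrr add0r mulmxBl scalerBr -scalemxAl mul1mx.
by rewrite scalerA addrC.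
Qed.

End rank_one_update.

End passage_equation.

(** * The linear equation of the weighted passage matrix *)

Section passage_matrix.
Context (R : realType) (m : nat).
Variables (P : 'M[R]_m) (pi mu : 'cV[R]_m) (lambda : R) (y : 'I_m -> 'cV[R]_m).
Hypothesis pi_stat : pi^T *m P = pi^T.
Hypothesis lambda_def : pi^T *m mu = lambda%:M.
Hypothesis y_eq : forall j, y j = mu + taboo P j *m y j.

(** Pairing [y_eq] with pi leaves pi^T y_j on both sides, where it cancels; this is Kac's formula
    for the mean return time. *)
Lemma stationary_return j : pi j 0 * y j j 0 = lambda.
Proof.
have /(congr1 (mulmx pi^T)) := y_eq j.
rewrite mulmxDr lambda_def (stationary_taboo pi_stat) addrCA.
rewrite -[LHS]addr0 => /addrI/esym/eqP; rewrite subr_eq0.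
by move=> /eqP/matrixP/(_ 0 0); rewrite !mxE eqxx !mulr1n.
Qed.

Lemma passage_matrix_eq :
  (1%:M - P) *m \matrix_(i, j) (if i == j then 0 else pi j 0 * y j i 0) =
  mu *m pi^T - lambda%:M.
Proof.
set K := \matrix_(i, j) _.
have colK j : col j K = pi j 0 *: (y j - y j j 0 *: delta_mx j 0).
  apply/matrixP => i a; rewrite ord1 !mxE eqxx andbT.
  by case: eqVneq => [->|_]; rewrite ?mulr1 ?subrr ?mulr0 ?subr0.
(* Clearing the diagonal entry contributes y_jj times column j of P, which cancels the taboo
   correction in P y_j. *)
have Aj j : (1%:M - P) *m col j K = pi j 0 *: mu - lambda *: delta_mx j 0.
  rewrite colK -scalemxAr mulmxBr -scalemxAr !mulmxBl !mul1mx -colE.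
  have -> : P *m y j = y j - mu + y j j 0 *: col j P.
    by apply/eqP; rewrite -subr_eq -taboo_mul eq_sym subr_eq addrC -y_eq.
  rewrite -(stationary_return j) -scalerA -scalerBr; congr (_ *: _).
  by rewrite scalerBr opprD addrA subKr opprB addrA subrK.
apply/matrixP => i j; have /matrixP/(_ i 0) := Aj j.
rewrite colE mulmxA -colE mxE => ->; rewrite !mxE big_ord1 !mxE eqxx andbT.
by rewrite (mulrC (mu i 0)) mulr_natr.
Qed.

End passage_matrix.

(** * Mean of a nonnegative variable on an event, from its distribution function *)

Section scaled_law.
Context d (Omega : measurableType d) (R : realType).
Variables (p : probability Omega R) (F : cumulative R R) (c : {nonneg R}).
Variables (phi : Omega -> R) (E : set Omega).
Hypothesis mE : measurable E.
Hypothesis mphi : measurable_fun setT phi.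
Hypothesis phi_ge0 : forall w, 0 <= phi w.
Hypothesis phi_law : forall t,
  p (E `&` [set w | phi w <= t]) = (c%:num%:E * (F t)%:E)%E.

(** [phi] retyped into the measurable structure on which [lebesgue_stieltjes_measure] lives. *)
Let phi_ : Omega -> measurableTypeR R := phi.

Let mphi_ : measurable_fun setT phi_.
Proof. exact: mphi. Qed.

Let nu := pushforward (mrestr p mE) phi_.

Let m_le t : measurable (E `&` [set w | phi w <= t]).
Proof.
apply: measurableI => //; rewrite -[X in measurable X]setTI.
by have := mphi measurableT (measurable_itv `]-oo, t]); rewrite set_itvE.
Qed.

(** Both measures agree on the half-open intervals, a generating family stable under intersection;
    the intervals ]-k, k] exhaust the line with finite mass, so uniqueness of measures applies. *)
Let scaled_law (A : set (measurableTypeR R)) : measurable A ->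
  nu A = mscale c (lebesgue_stieltjes_measure F) A.
Proof.
have nu_itv a b : nu `]a, b]%classic =
    mscale c (lebesgue_stieltjes_measure F) `]a, b]%classic.
  have [ab|ba] := leP a b; last first.
    by rewrite set_itv_ge ?bnd_simp -?leNgt ?ltW// /nu /pushforward
       preimage_set0 !measure0.
  rewrite /mscale/= /lebesgue_stieltjes_measure/= /measure_extension/=.
  rewrite measurable_mu_extE/=; last exact: is_ocitv.
  rewrite wlength_itv_bnd// EFinB muleBr ?fin_num_adde_defl//.
  have sub : E `&` [set w | phi w <= a] `<=` E `&` [set w | phi w <= b].
    by move=> w [Ew /= wa]; split=> //=; exact: le_trans ab.
  rewrite -!phi_law -(setIidr sub) -measureD//=; last first.
    by rewrite (le_lt_trans (probability_le1 _ _)) ?ltry.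
  rewrite /nu /pushforward /mrestr; congr (p _); apply/seteqP; split=> w /=.
    by rewrite in_itv/= => -[/andP[aw wb] Ew]; split=> // -[_];
      rewrite leNgt aw.
  move=> [[Ew wb] H]; rewrite in_itv/= wb andbT; split=> //.
  by rewrite ltNge; apply/negP => wa; apply: H.
apply: (@measure_unique _ R (measurableTypeR R) (@ocitv R)
  (fun k => `]- k%:R, k%:R]%classic)).
- by [].
- exact: ocitvI.
- by move=> k; exact: is_ocitv.
- rewrite -subTset => /= x _ /=.
  exists (Num.bound `|x|) => //=; rewrite in_itv/=.
  by have := archi_boundP (normr_ge0 x); rewrite ltr_norml => /andP[-> /ltW].
- by move=> _ [[a b] _ <-]; exact: nu_itv.
- move=> k; rewrite /= /pushforward /mrestr.
  rewrite (le_lt_trans (probability_le1 _ _)) ?ltry//.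
  apply: measurableI => //; rewrite -[X in measurable X]setTI.
  by apply: mphi_ => //; apply: sub_sigma_algebra; exact: is_ocitv.
Qed.

Lemma integral_scaled_law : (\int[p]_(w in E) (phi w)%:E =
  c%:num%:E *
    \int[lebesgue_stieltjes_measure F]_(t in `[0%R, +oo[) t%:E)%E.
Proof.
rewrite -ge0_integral_mscale//; last first.
  by move=> x /=; rewrite in_itv/= andbT lee_fin.
have lawE (A : set (measurableTypeR R)) : measurable A -> A `<=` `[0%R,
  +oo[%classic ->
    mscale c (lebesgue_stieltjes_measure F) A =
    pushforward (mrestr p mE) phi_ A.
  by move=> mA _; rewrite -scaled_law.
rewrite (eq_measure_integral (pushforward (mrestr p mE) phi_) lawE).
rewrite ge0_integral_pushforward//; last first.
  by move=> x; rewrite inE/= in_itv/= andbT lee_fin.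
have -> : phi_ @^-1` `[0, +oo[ = setT.
  by apply/seteqP; split=> // w _ /=; rewrite in_itv/= phi_ge0.
(* The restricted measure gives no mass to the complement of E, so the domain shrinks back to E. *)
rewrite (@ge0_negligible_integral _ _ _ (mrestr p mE) setT (~` E))//=.
- rewrite setDE setCK setTI; apply: eq_measure_integral => A mA AE /=.
  by rewrite /mrestr setIidl.
- exact: measurableC.
- exact/measurable_EFinP.
- by move=> w _; rewrite lee_fin.
- by rewrite /mrestr setICl measure0.
Qed.

End scaled_law.

(** * Events of the past and decomposition by the current state *)

Section markov_renewal_law.
Context (R : realType) (m : nat) d (Omega : measurableType d).
Variables (X : nat -> Omega -> 'I_m) (T : nat -> Omega -> R).
Variable Q : 'I_m -> 'I_m -> cumulative R R.
Variable p : probability Omega R.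
Hypothesis p_MRP : is_MRP X T p Q.

Let inc n w := T n.+1 w - T n w.

Lemma past_preimage n k (A : set 'I_m) : (k <= n)%N -> past X T n (X k @^-1` A).
Proof. by move=> kn; apply: sub_sigma_algebra; exists k => //; left;
  exists A. Qed.

Lemma measurable_state n (A : set 'I_m) : measurable (X n @^-1` A).
Proof.
have -> : X n @^-1` A = \bigcup_(k in A) X n @^-1` [set k].
  by apply/seteqP; split=> [w Aw|w [k Ak /= ->]]//; exists (X n w).
apply: fin_bigcup_measurable => // k _.
exact: MRP_measurable_state p_MRP _ _.
Qed.

Lemma past_measurable n H : past X T n H -> measurable H.
Proof.
apply: smallest_sub; first exact: sigma_algebra_measurable.
move=> _ [k _ [[A ->]|[B mB ->]]]; first exact: measurable_state.
by rewrite -[X in measurable X]setTI; exact: (MRP_measurable_time p_MRP).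
Qed.

Lemma inc_ge0 n w : 0 <= inc n w.
Proof. by rewrite subr_ge0; exact: MRP_time_nondecreasing p_MRP _ _. Qed.

Lemma measurable_inc n : measurable_fun setT (inc n).
Proof. by apply: measurable_funB; exact: (MRP_measurable_time p_MRP). Qed.

Lemma measurable_inc_le n t : measurable [set w | inc n w <= t].
Proof.
rewrite -[X in measurable X]setTI.
by have := @measurable_inc n measurableT _ (measurable_itv `]-oo, t]);
  rewrite set_itvE.
Qed.

Lemma state_disjoint n (D : set Omega) :
  trivIset setT (fun k : 'I_m => D `&` [set w | X n w = k]).
Proof.
apply/trivIsetP => k l _ _ kl; rewrite -subset0 => w /= [[_ wk] [_ wl]].
by move: kl; rewrite -wk -wl eqxx.
Qed.

Lemma state_cover n (D : set Omega) :
  \big[setU/set0]_(k < m) (D `&` [set w | X n w = k]) = D.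
Proof.
rewrite -bigcup_seq; apply/seteqP; split=> [w [k _ []]//|w Dw].
by exists (X n w) => //=; rewrite mem_index_enum.
Qed.

Lemma measure_state_sum n D : measurable D ->
  p D = (\sum_k p (D `&` [set w | X n w = k]))%E.
Proof.
move=> mD; rewrite -{1}(state_cover n D) measure_bigsetU_ord//.
- by move=> k; apply: measurableI => //; exact: (measurable_state _ [set k]).
- exact: state_disjoint.
Qed.

Lemma integral_state_sum n D (f : Omega -> \bar R) : measurable D ->
  measurable_fun D f -> (forall w, D w -> (0 <= f w)%E) ->
  (\int[p]_(w in D) f w =
    \sum_k \int[p]_(w in D `&` [set w | X n w = k]) f w)%E.
Proof.
move=> mD mf f0; rewrite -{1}(state_cover n D) ge0_integral_bigsetU//.
- by move=> k; apply: measurableI => //; exact: (measurable_state _ [set k]).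
- exact: index_enum_uniq.
- by apply: sub_trivIset (@state_disjoint n D).
- by rewrite state_cover.
- by rewrite state_cover.
Qed.

(** Time 0 is left out, so a path started in j avoids j until it returns. *)
Definition avoid (j : 'I_m) n : set Omega :=
  [set w | forall k, (0 < k <= n)%N -> X k w != j].

Lemma past_avoid j n : past X T n (avoid j n).
Proof.
(* Padding with empty sets gives a countable union, the form under which a sigma-algebra is
   closed. *)
pose B k := if (0 < k <= n)%N then X k @^-1` [set j] else set0.
have -> : avoid j n = ~` \bigcup_k B k.
  apply/seteqP; split=> [w wn [k _]|w wn k kn].
    by rewrite /B; case: ifP => // kn /= /eqP; rewrite (negbTE (wn k kn)).
  by apply/eqP => Xk; apply: wn; exists k => //; rewrite /B kn.
apply: sigma_algebraC; apply: sigma_algebra_bigcup => k.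
rewrite /B; case: ifP => [/andP[_ kn]|_]; first exact: past_preimage.
exact: sigma_algebra0.
Qed.

Lemma measurable_avoid j n : measurable (avoid j n).
Proof. by apply: (@past_measurable n); exact: past_avoid. Qed.

Lemma avoid0 j : avoid j 0 = setT.
Proof. by apply/seteqP; split=> // w _ [|k] /andP[]. Qed.

Lemma avoidS j n : avoid j n.+1 = avoid j n `&` [set w | X n.+1 w != j].
Proof.
apply/seteqP; split=> w.
  move=> wn; split=> [k /andP[k0 kn]|]; last by apply: wn; rewrite leqnn.
  by apply: wn; rewrite k0 leqW.
move=> [wn wj] k /andP[k0]; rewrite leq_eqVlt => /predU1P[->//|kn].
by apply: wn; rewrite k0.
Qed.

End markov_renewal_law.

(** * Transition probabilities and mean increments on taboo events *)

Section markov_renewal_moments.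
Context (R : realType) (m : nat) d (Omega : measurableType d).
Variables (X : nat -> Omega -> 'I_m) (T : nat -> Omega -> R).
Variable Q : 'I_m -> 'I_m -> cumulative R R.
Variable Pr : 'I_m -> probability Omega R.
Hypothesis Pr_MRP : forall i, is_MRP X T (Pr i) Q.
Hypothesis Pr_init : forall i, Pr i [set w | X 0%N w = i] = 1%E.
Local Notation P := (transition_matrix Q).
Local Notation e := (const_mx 1 : 'cV[R]_m).

Let inc n w := T n.+1 w - T n w.

Lemma init_law i k : Pr i [set w | X 0%N w = k] = (i == k)%:R%:E.
Proof.
have [<-|ik] := eqVneq i k; first exact: Pr_init.
have N0 : Pr i (~` [set w | X 0%N w = i]) = 0%E.
  by rewrite probability_setC ?Pr_init ?subee//;
    exact: (measurable_state (Pr_MRP i) _ [set i]).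
apply: (subset_measure0 _ _ _ N0).
- exact: (measurable_state (Pr_MRP i) _ [set k]).
- by apply: measurableC; exact: (measurable_state (Pr_MRP i) _ [set i]).
- by move=> w /= -> /esym/eqP; rewrite (negbTE ik).
Qed.

(** The Markov property at step 0, where the conditioning event has full mass under [Pr k]. Kernel
    values are thus genuine probabilities, whence their bounds. *)
Lemma kernelE k l t :
  Pr k ([set w | X 0%N w = k] `&` [set w | X 1%N w = l /\ inc 0 w <= t]) =
  (Q k l t)%:E.
Proof.
have := @MRP_markov _ _ _ _ _ _ _ _ (Pr_MRP k) 0 k l t setT;
  rewrite !setTI Pr_init mul1e; apply.
by have := @past_preimage _ _ _ _ X T 0 0 setT isT; rewrite preimage_setT.
Qed.

Lemma kernel_bounds k l t : 0 <= Q k l t <= 1.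
Proof.
rewrite -!lee_fin -kernelE measure_ge0 probability_le1//.
apply: measurableI; first exact: (measurable_state (Pr_MRP k) _ [set k]).
apply: measurableI; first exact: (measurable_state (Pr_MRP k) _ [set l]).
exact: (measurable_inc_le (Pr_MRP k)).
Qed.

(** Monotonicity and boundedness make the [lim] in [transition_matrix] a true limit. *)
Lemma kernel_cvg k l : Q k l n%:R @[n --> \oo] --> P k l.
Proof.
have : cvg (Q k l t @[t --> +oo]).
  apply: cvgP; apply: nondecreasing_cvgr.
    exact: cumulative_is_nondecreasing.
  by exists 1 => _ [t _ <-]; have /andP[] := kernel_bounds k l t.
by rewrite mxE => H; exact: (cvg_comp _ _ cvgr_idn H).
Qed.

(** In [MRP_markov] let t grow along the integers: increments are finite, so the events increase to
    the one without time bound, and continuity from below applies. *)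
Lemma markov_step i n k l H : past X T n H ->
  Pr i (H `&` [set w | X n w = k] `&` [set w | X n.+1 w = l]) =
  (Pr i (H `&` [set w | X n w = k]) * (P k l)%:E)%E.
Proof.
move=> pH; set D := H `&` _.
have mD : measurable D.
  by apply: measurableI; [exact: (past_measurable (Pr_MRP i) pH)|exact:
    (measurable_state (Pr_MRP i) _ [set k])].
pose F a := D `&` [set w | X n.+1 w = l /\ inc n w <= a%:R].
have mF a : measurable (F a).
  apply: measurableI => //; apply: measurableI.
    exact: (measurable_state (Pr_MRP i) _ [set l]).
  exact: (measurable_inc_le (Pr_MRP i)).
have UF : \bigcup_a F a = D `&` [set w | X n.+1 w = l].
  apply/seteqP; split=> [w [a _ [Dw [Xw _]]]|w [Dw Xw]]; first by split.
  exists (Num.bound (inc n w)) => //; split=> //; split=> //.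
  by rewrite ltW// archi_boundP// (inc_ge0 (Pr_MRP i)).
have c1 : Pr i (F a) @[a --> \oo] --> Pr i (D `&` [set w | X n.+1 w = l]).
  rewrite -UF; apply: nondecreasing_cvg_mu => //;
    first exact: bigcup_measurable.
  apply/nondecreasing_seqP => a; apply/subsetPset => w [Dw [Xw /= H1]].
  by split=> //; split=> //; rewrite (le_trans H1)// ler_nat.
have c2 : Pr i (F a) @[a --> \oo] --> (Pr i D * (P k l)%:E)%E.
  under eq_fun do rewrite (@MRP_markov _ _ _ _ _ _ _ _ (Pr_MRP i) n k l _ _ pH).
  have Dfin : Pr i D \is a fin_num by rewrite fin_num_measure.
  rewrite -(fineK Dfin) -EFinM.
  under eq_fun do rewrite -EFinM.
  by apply: cvg_EFin; [exact: nearW|apply: cvgMl_tmp; exact: kernel_cvg].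
exact: (cvg_unique _ c1 c2).
Qed.

Lemma transition_law k l :
  Pr k ([set w | X 0%N w = k] `&` [set w | X 1%N w = l]) = (P k l)%:E.
Proof.
have := @markov_step k 0 k l setT; rewrite !setTI Pr_init mul1e; apply.
by have := @past_preimage _ _ _ _ X T 0 0 setT isT; rewrite preimage_setT.
Qed.

Lemma transition_ge0 k l : 0 <= P k l.
Proof. by rewrite -lee_fin -transition_law measure_ge0. Qed.

Lemma transition_row : P *m e = e.
Proof.
apply/matrixP => k a; rewrite ord1 mxE [RHS]mxE.
under eq_bigr do rewrite [e _ _]mxE mulr1.
apply: EFin_inj; rewrite -sumEFin -(Pr_init k) (measure_state_sum (Pr_MRP k) 1).
  by apply: eq_bigr => l _; rewrite transition_law.
exact: (measurable_state (Pr_MRP k) _ [set k]).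
Qed.

Hypothesis mu_fin : forall i j, (mean_sojourn_part Q i j < +oo)%E.

Lemma mean_sojourn_part_ge0 k l : (0 <= mean_sojourn_part Q k l)%E.
Proof. by apply: integral_ge0 => t /=; rewrite in_itv/= andbT lee_fin. Qed.

(** Split by the next state l. On each piece the increment has law Pr(D) Q_kl, so
    [integral_scaled_law] evaluates its mean, and the parts add up to mu_k. *)
Lemma markov_mean i n k H : past X T n H ->
  (\int[Pr i]_(w in H `&` [set w | X n w = k]) (inc n w)%:E =
   Pr i (H `&` [set w | X n w = k]) * (mean_sojourn Q k 0)%:E)%E.
Proof.
move=> pH; set D := H `&` _.
have mD : measurable D.
  by apply: measurableI; [exact: (past_measurable (Pr_MRP i) pH)|exact:
    (measurable_state (Pr_MRP i) _ [set k])].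
have Dfin : Pr i D \is a fin_num by rewrite fin_num_measure.
have minc : measurable_fun D (fun w => (inc n w)%:E).
  by apply: measurable_funTS; apply/measurable_EFinP;
    exact: (measurable_inc (Pr_MRP i)).
rewrite (integral_state_sum (Pr_MRP i) n.+1)//; last first.
  by move=> w _; rewrite lee_fin (inc_ge0 (Pr_MRP i)).
rewrite mxE -sumEFin ge0_sume_distrr; last first.
  by move=> l _; rewrite fineK ?mean_sojourn_part_ge0// ge0_fin_numE
    ?mean_sojourn_part_ge0.
apply: eq_bigr => l _.
rewrite fineK ?ge0_fin_numE ?mean_sojourn_part_ge0//.
have c_ge0 : 0 <= fine (Pr i D) by rewrite fine_ge0.
have -> : Pr i D = ((NngNum c_ge0)%:num)%:E by rewrite /= fineK.
apply: integral_scaled_law => //.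
- by apply: measurableI => //; exact: (measurable_state (Pr_MRP i) _ [set l]).
- exact: (measurable_inc (Pr_MRP i)).
- by move=> w; exact: (inc_ge0 (Pr_MRP i)).
- move=> t; rewrite /= fineK// -(@MRP_markov _ _ _ _ _ _ _ _ (Pr_MRP i) n k l
  t _ pH).
  by rewrite -!setIA.
Qed.

Lemma avoid_law i j n k :
  Pr i (avoid X j n `&` [set w | X n w = k]) = ((taboo P j ^+ n) i k)%:E.
Proof.
elim: n k => [|n IH] l; first by rewrite avoid0 setTI init_law expr0 !mxE.
(* For l = j both sides vanish: the event is empty and column j of the taboo matrix is zero. *)
rewrite exprSr_mx mxE; have [->|lj] := eqVneq l j.
  rewrite big1 => [|k _]; last by rewrite !mxE eqxx mulr0.
  rewrite avoidS -setIA [X in _ `&` X](_ : _ = set0) ?setI0 ?measure0//.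
  by rewrite -subset0 => w /= [/eqP].
(* For l != j avoidance at step n+1 is automatic, which leaves an event of the past up to n, as
   [markov_step] requires. *)
have -> : avoid X j n.+1 `&` [set w | X n.+1 w = l] =
          avoid X j n `&` [set w | X n.+1 w = l].
  rewrite avoidS -setIA; congr (_ `&` _); apply/seteqP;
    split=> [w []//|w /= wl].
  by split=> //=; rewrite wl.
rewrite (measure_state_sum (Pr_MRP i) n); last first.
  by apply: measurableI; [exact: (measurable_avoid (Pr_MRP i))|exact:
    (measurable_state (Pr_MRP i) _ [set l])].
rewrite -sumEFin; apply: eq_bigr => k _.
by rewrite setIAC markov_step ?IH;
  [rewrite -EFinM [taboo _ _ k l]mxE (negbTE lj)|exact: (past_avoid (T := T))].
Qed.

Lemma avoid_measure i j n : Pr i (avoid X j n) = ((taboo P j ^+ n *m e) i 0)%:E.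
Proof.
rewrite (measure_state_sum (Pr_MRP i) n);
  last exact: (measurable_avoid (Pr_MRP i)).
rewrite mxE -sumEFin; apply: eq_bigr => k _.
by rewrite avoid_law mxE mulr1.
Qed.

Lemma avoid_mean i j n : (\int[Pr i]_(w in avoid X j n) (inc n w)%:E =
  ((taboo P j ^+ n *m mean_sojourn Q) i 0)%:E)%E.
Proof.
rewrite (integral_state_sum (Pr_MRP i) n).
- rewrite mxE -sumEFin; apply: eq_bigr => k _.
  by rewrite markov_mean ?avoid_law ?EFinM//; exact: (past_avoid (T := T)).
- exact: (measurable_avoid (Pr_MRP i)).
- by apply: measurable_funTS; apply/measurable_EFinP;
  exact: (measurable_inc (Pr_MRP i)).
- by move=> w _; rewrite lee_fin (inc_ge0 (Pr_MRP i)).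
Qed.

End markov_renewal_moments.

(** * The mean first passage time as a Neumann series *)

Section mean_first_passage_time.
Context (R : realType) (m : nat) d (Omega : measurableType d).
Variables (X : nat -> Omega -> 'I_m) (T : nat -> Omega -> R).
Variable Q : 'I_m -> 'I_m -> cumulative R R.
Variable Pr : 'I_m -> probability Omega R.
Hypothesis Pr_MRP : forall i, is_MRP X T (Pr i) Q.
Hypothesis Pr_init : forall i, Pr i [set w | X 0%N w = i] = 1%E.
Hypothesis mu_fin : forall i j, (mean_sojourn_part Q i j < +oo)%E.
Local Notation P := (transition_matrix Q).
Local Notation e := (const_mx 1 : 'cV[R]_m).
Hypothesis P_irr : irreducible_mx P.
Variable pi : 'cV[R]_m.
Hypothesis pi_stat : pi^T *m P = pi^T.
Hypothesis pi_sum : pi^T *m e = 1%:M.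

Let inc n w := T n.+1 w - T n w.

Let never (j : 'I_m) : set Omega := \bigcap_n avoid X j n.

Let step j n : Omega -> \bar R := (EFin \o inc n) \_ (avoid X j n).

(** The event lies in every [avoid X j n], whose mass (B_j^n e)_i tends to 0. *)
Lemma never_null i j : Pr i (never j) = 0%E.
Proof.
apply/eqP; rewrite eq_le measure_ge0 andbT.
have B0 := taboo_expr_cvg0 (transition_ge0 Pr_MRP Pr_init)
  (transition_row Pr_MRP Pr_init) P_irr pi_stat pi_sum j i.
have c0 : ((taboo P j ^+ n *m e) i 0)%:E @[n --> \oo] --> (0%R)%:E.
  by apply: cvg_EFin; [exact: nearW|exact: B0].
apply: (cvge_ge _ c0); apply: nearW => n.
rewrite -(avoid_measure Pr_MRP Pr_init); apply: le_measure; rewrite ?inE.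
- by apply: bigcapT_measurable => k; exact: (measurable_avoid (Pr_MRP i)).
- exact: (measurable_avoid (Pr_MRP i)).
- by move=> w; exact.
Qed.

(** If the first visit occurs at step r, exactly the increments of index below r count, and they
    telescope to T_r - T_0. The last term supplies +oo on paths without a visit. The state i selects
    a law whose [is_MRP] record gives T_0 = 0 and the monotonicity of T. *)
Lemma first_passage_timeE (i j : 'I_m) w : first_passage_time X T j w =
  (\sum_(n <oo) step j n w + (cst +oo \_ (never j)) w)%E.
Proof.
have step_ge0 n : (0 <= step j n w)%E.
  by rewrite /step patchE; case: ifP => // _;
    rewrite lee_fin (inc_ge0 (Pr_MRP i)).
rewrite /first_passage_time; case: pselect => [ex|nex].
  case: ex_minnP => r /andP[r_gt0 /eqP Xr] r_min.
  have -> : (cst +oo%E \_ (never j)) w = 0%E :> \bar R.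
    rewrite patchE memNset// => /(_ r I r); rewrite r_gt0 leqnn Xr eqxx.
    by move=> /(_ isT).
  rewrite adde0 (@nneseries_split _ _ 0 r)// add0n eseries0 ?adde0; last first.
    move=> n rn _; rewrite /step patchE memNset// => /(_ r).
    by rewrite r_gt0 rn Xr eqxx => /(_ isT).
  rewrite (eq_big_nat _ _ (F2 := fun n => (inc n w)%:E)); last first.
    move=> n /andP[_ nr]; rewrite /step patchE mem_set// => k /andP[k0 kn].
    apply: contraTneq nr => Xk; rewrite -leqNgt (leq_trans (r_min k _) kn)//.
    by rewrite k0 Xk eqxx.
  rewrite sumEFin telescope_sumr// (MRP_time0 (Pr_MRP i)) subr0 //.
rewrite patchE mem_set/= ?addey//.
  by rewrite gt_eqF// (lt_le_trans _ (nneseries_ge0 _))// ltNyr.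
move=> n _ k /andP[k0 _]; apply/negP => Xk; apply: nex.
by exists k; rewrite k0 Xk.
Qed.

(** Monotone convergence integrates the series termwise, [avoid_mean] evaluates the terms, and
    [taboo_series_cvg] sums them. *)
Lemma mean_first_passageE i j : mean_first_passage X T Pr i j =
  ((invmx (1%:M - taboo P j) *m mean_sojourn Q) i 0)%:E.
Proof.
have mnever : measurable (never j).
  by apply: bigcapT_measurable => k; exact: (measurable_avoid (Pr_MRP i)).
have step_ge0 n w : (0 <= step j n w)%E.
  by rewrite /step patchE; case: ifP => // _;
    rewrite lee_fin (inc_ge0 (Pr_MRP i)).
have mstep n : measurable_fun setT (step j n).
  apply/(measurable_restrictT _ _).1;
    first exact: (measurable_avoid (Pr_MRP i)).
  apply: measurable_funTS; apply/measurable_EFinP.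
  exact: (measurable_inc (Pr_MRP i)).
rewrite /mean_first_passage.
under eq_integral do rewrite (first_passage_timeE i).
rewrite ge0_integralD//=; first last.
- by apply/(measurable_restrictT _ _).1.
- by move=> w _; rewrite patchE; case: ifP => _; rewrite ?leey.
- by apply: (ge0_emeasurable_sum (P := xpredT)).
- by move=> w _; exact: nneseries_ge0.
(* The infinite value sits on a null event, and +oo times 0 is 0. *)
rewrite -integral_mkcond integral_cst// [X in (_ * X)%E](never_null i j) mule0
  adde0.
rewrite integral_nneseries//.
under eq_eseriesr do rewrite -integral_mkcond (avoid_mean Pr_MRP Pr_init
  mu_fin).
apply/cvg_lim => //.
under eq_fun do rewrite sumEFin.
apply: cvg_EFin; first exact: nearW.
exact: (taboo_series_cvg (transition_ge0 Pr_MRP Pr_init)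
  (transition_row Pr_MRP Pr_init) P_irr pi_stat pi_sum).
Qed.

End mean_first_passage_time.

Theorem corollary1p2
  (R : realType) (m : nat)
  (d : measure_display) (Omega : measurableType d)
  (X : nat -> Omega -> 'I_m) (T : nat -> Omega -> R)
  (Q : 'I_m -> 'I_m -> cumulative R R)
  (Pr : 'I_m -> probability Omega R)
  (Pr_MRP : forall i, is_MRP X T (Pr i) Q)
  (Pr_init : forall i, Pr i [set w | X 0%N w = i] = 1%E)
  (P : 'M[R]_m) (P_def : P = transition_matrix Q)
  (P_irr : irreducible_mx P)
  (mu_fin : forall i j, (mean_sojourn_part Q i j < +oo)%E)
  (mu : 'cV[R]_m) (mu_def : mu = mean_sojourn Q)
  (e : 'cV[R]_m) (e_def : e = const_mx 1)
  (pi : 'cV[R]_m) (pi_stat : pi^T *m P = pi^T) (pi_sum : pi^T *m e = 1%:M)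
  (lambda : R) (lambda_def : lambda = (pi^T *m mu) 0 0)
  (lambda_gt0 : 0 < lambda)
  (k : 'cV[\bar R]_m) (k_def : k = weighted_mean_passage X T Pr pi) :
  (* (a) *)
  (forall G : 'M[R]_m, is_g_inverse (1%:M - P) G ->
     k = map_mx EFin
       (G *m mu - \tr (G *m mu *m pi^T) *: e
        - lambda *: (G *m e) + (lambda * \tr G) *: e)) /\
  (* (b) *)
  (1%:M - P + e *m pi^T \in unitmx /\
   let Z := invmx (1%:M - P + e *m pi^T) in
     k = map_mx EFin
       (Z *m mu - \tr (Z *m mu *m pi^T) *: e + (lambda * (\tr Z - 1)) *: e)) /\
  (* (c) *)
  (forall Ag : 'M[R]_m, is_group_inverse (1%:M - P) Ag ->
     k = map_mx EFin
       (Ag *m mu - \tr (Ag *m mu *m pi^T) *: e + (lambda * \tr Ag) *: e)) /\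
  (* (d) *)
  (forall u : 'cV[R]_m, (u^T *m e) 0 0 != 0 ->
     1%:M - P + mu *m u^T \in unitmx /\
     let Gt := invmx (1%:M - P + mu *m u^T) in
       k = map_mx EFin (lambda *: (((\tr Gt) *: 1%:M - Gt) *m e))).
Proof.
subst P mu e.
have P_ge0 := transition_ge0 Pr_MRP Pr_init.
have P_row := transition_row Pr_MRP Pr_init.
have fixP := fixed_const P_ge0 P_row P_irr.
set P := transition_matrix Q in P_irr pi_stat P_ge0 P_row fixP *.
set mu := mean_sojourn Q in lambda_def *.
set e := const_mx 1 in P_row fixP pi_sum *.
pose y j := invmx (1%:M - taboo P j) *m mu.
pose K := \matrix_(i, j) (if i == j then 0 else pi j 0 * y j i 0).
have y_eq j : y j = mu + taboo P j *m y j.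
  apply/eqP; rewrite -subr_eq -{1}[y j]mul1mx -mulmxBl mulKVmx//.
  exact: (unitmx_taboo P_ge0 P_row P_irr pi_stat pi_sum).
have pi_mu : pi^T *m mu = lambda%:M by rewrite lambda_def [LHS]mx11_scalar.
have lambda_neq0 : lambda != 0 by rewrite gt_eqF.
have K_eq : (1%:M - P) *m K = mu *m pi^T - lambda%:M.
  exact: (passage_matrix_eq pi_stat pi_mu y_eq).
have K_diag i : K i i = 0 by rewrite mxE eqxx.
(* The zero diagonal of K turns the sum over j != i into a full row sum, and the finite passage
   means let it be taken in the reals. *)
have -> : k = map_mx EFin (K *m e).
  rewrite k_def; apply/matrixP => i a; rewrite ord1 [LHS]mxE [RHS]mxE.
  rewrite [(K *m e) i 0]mxE -sumEFin big_mkcond.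
  apply: eq_bigr => j _; rewrite [e j 0]mxE mulr1 [K i j]mxE eq_sym.
  case: eqVneq => // _.
  by rewrite (mean_first_passageE Pr_MRP Pr_init mu_fin P_irr pi_stat pi_sum).
split; [|split; [split|split]].
- by move=> G /(g_inverse_passage fixP pi_sum K_eq K_diag) ->.
- exact: (fundamental_unitmx fixP pi_stat pi_sum).
- by move=> Z; rewrite (fundamental_passage fixP P_row pi_stat pi_sum K_eq
  K_diag).
- by move=> Ag /(group_inverse_passage fixP P_row pi_sum K_eq K_diag) ->.
- move=> u ue; split; first exact: (rank_one_unitmx fixP pi_stat pi_mu
  lambda_neq0 ue).
  move=> Gt.
  by rewrite (rank_one_passage fixP P_row pi_stat pi_sum pi_mu lambda_neq0
    K_eq K_diag ue).
Qed.
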